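(* Let $F \subset (c_0)_+$ be a non-empty, at most countable set. Then there is a sequence $g \in (c_0)_+$ such that $(c_0)_f \subset (c_0)_g$ for all $f \in F$.
   Context: $c_0 = c_0(\mathbb{N}_0;\mathbb{C})$ is the space of complex sequences indexed by $\mathbb{N}_0$ that converge to $0$, and $(c_0)_+$ is the set of those $f \in c_0$ all of whose entries are real and non-negative. For $g = (g_n) \in c_0$, $|g| := (|g_n|)_{n \in \mathbb{N}_0}$. Inequalities between real sequences are understood entrywise. For $f \in (c_0)_+$, the principal ideal generated by $f$ is $(c_0)_f = \{g \in c_0 : \exists c \ge 0,\ |g| \le c f\}$. *)

(* Defs.v *)
From mathcomp Require Import all_boot all_order all_algebra.
From mathcomp Require Import complex.
From mathcomp Require Import all_classical all_reals all_analysis.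
Set Implicit Arguments.
Unset Strict Implicit.
Unset Printing Implicit Defensive.
Import Order.TTheory GRing.Theory Num.Theory.
Import numFieldNormedType.Exports.

Local Open Scope classical_set_scope.
Local Open Scope complex_scope.
Local Open Scope ring_scope.

(* The topology of the normed field of complex numbers is carried by its
   regular-module copy [R[i]^o]; it is the one induced by the modulus. *)
Definition c0 (R : realType) : set (nat -> R[i]) :=
  [set f : nat -> R[i] | f @ \oo --> (0 : (R[i])^o)].

(* In the partial order of [R[i]], [x <= y] means that [y - x] is real and
   non-negative; in particular [0 <= z] forces [z] to be real. *)
Definition c0_pos (R : realType) : set (nat -> R[i]) :=
  [set f | c0 f /\ forall n, 0 <= f n].

Definition c0_ideal (R : realType) (f : nat -> R[i]) : set (nat -> R[i]) :=
  [set g | c0 g /\ exists2 c : R, 0 <= c & forall n, `|g n| <= c%:C * f n].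

(* Main.v *)
Require Import Defs.
From mathcomp Require Import all_boot all_order all_algebra.
From mathcomp Require Import complex.
From mathcomp Require Import all_classical all_reals all_analysis.
Import Order.TTheory GRing.Theory Num.Theory numFieldNormedType.Exports.
Local Open Scope classical_set_scope.
Local Open Scope complex_scope.
Local Open Scope ring_scope.

(** A positive null sequence [g] dominates [f] up to a constant as soon as
    [f n <= g n] eventually. Enumerate [F] as [f_0, f_1, ...] and take
    [g n := max (1/(n+1), max_(k < n) min (f_k n, 1/(k+1)))]. It is a null
    sequence, because only finitely many [k] satisfy [1/(k+1) > e]; and
    [f_k n <= g n] as soon as [n > k] and [f_k n <= 1/(k+1)]. *)

Lemma eventually_le_dominated {R : realFieldType} (f g : nat -> R) :
  (forall n, 0 <= f n) -> (forall n, 0 < g n) ->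
  (\forall n \near \oo, f n <= g n) ->
  exists2 c, 0 <= c & forall n, f n <= c * g n.
Proof.
move=> f_ge0 g_gt0 [N _ le_fg].
have q_ge0 i : 0 <= f i / g i by rewrite divr_ge0 // ltW.
have s_ge0 : 0 <= \sum_(i < N) f i / g i by apply: sumr_ge0.
(* The [1] serves the indices [n >= N]; for each [n < N] the summand [f n / g n] suffices, the
   others being non-negative. *)
exists (1 + \sum_(i < N) f i / g i); first by rewrite addr_ge0.
move=> n; have [leNn|ltnN] := leqP N n.
  by rewrite (le_trans (le_fg n leNn)) // ler_peMl ?(ltW (g_gt0 n)) ?lerDl.
rewrite -ler_pdivrMr // (bigD1 (Ordinal ltnN)) //= addrCA lerDl.
by rewrite addr_ge0 // sumr_ge0.
Qed.

Lemma countable_null_seq_dominated {R : realType} (f : nat -> nat -> R) :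
  (forall k n, 0 <= f k n) -> (forall k, f k @ \oo --> 0) ->
  exists g : nat -> R, [/\ forall n, 0 < g n, g @ \oo --> 0 &
    forall k, exists2 c, 0 <= c & forall n, f k n <= c * g n].
Proof.
move=> f_ge0 f_cvg.
(* The base value [harmonic n] keeps [g n] positive even where every [f k n] vanishes, or at
   [n = 0], where the range of [k] is empty. *)
pose g n := \big[Order.max/harmonic n]_(k < n) Order.min (f k n) (harmonic k).
have g_gt0 n : 0 < g n.
  by apply: lt_le_trans (bigmax_ge_id _ _ _ _); exact: harmonic_gt0.
exists g; split=> // [|k].
  apply/cvgrPdist_le => e e_gt0.
  have small (u : nat -> R) : u @ \oo --> 0 -> \forall n \near \oo, u n <= e.
    move=> /cvgrPdist_le /(_ e e_gt0); apply: filterS => n.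
    by rewrite sub0r normrN; apply: le_trans (ler_norm _).
  have [K _ harm_le] := small _ cvg_harmonic.
  (* Only the finitely many [k < K] need a common threshold in [n]; for [k >= K] the cap
     [harmonic k] is at most [e] whatever [n] is. *)
  have f_le : \forall n \near \oo, forall k : 'I_K, f k n <= e.
    by apply: filter_forall => k; exact: small.
  near=> n; rewrite sub0r normrN gtr0_norm //.
  apply: bigmax_le => [|k _]; first by apply: harm_le; near: n; exists K.
  rewrite ge_min; have [leKk|ltkK] := leqP K k; first by rewrite harm_le ?orbT.
  by have /(_ (Ordinal ltkK)) -> : forall k : 'I_K, f k n <= e by near: n.
apply: eventually_le_dominated => //.
have /cvgrPdist_le /(_ _ (harmonic_gt0 k)) f_le := f_cvg k.
near=> n.
have ltkn : (k < n)%N by near: n; exists k.+1.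
apply: le_trans (le_bigmax _ _ (Ordinal ltkn)); rewrite le_min lexx /=.
by rewrite -[f k n]ger0_norm // -normrN -sub0r; near: n.
Unshelve. all: by end_near. Qed.

(** The modulus of an embedded real is its absolute value. This reduces the theorem to real
    sequences. *)
Lemma c0_real {R : realType} (u : nat -> R) :
  c0 (fun n => (u n)%:C) <-> u @ \oo --> 0.
Proof.
rewrite /c0 /=; split=> [/(@cvgrPdist_le _ R[i]^o) cvg_u|/cvgrPdist_le cvg_u].
  apply/cvgrPdist_le => e e_gt0.
  have := cvg_u e%:C; rewrite ltcR => /(_ e_gt0); apply: filterS => n.
  by rewrite !sub0r !normrN normc_def /= expr0n addr0 sqrtr_sqr lecR.
apply/(@cvgrPdist_le _ R[i]^o) => e e_gt0.
(* A positive element of [R[i]] is real, so complex tolerances are just real ones. *)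
have e_real : e = (complex.Re e)%:C by rewrite RRe_real // gtr0_real.
move: e_gt0; rewrite e_real ltcR => /cvg_u; apply: filterS => n.
by rewrite !sub0r !normrN normc_def /= expr0n addr0 sqrtr_sqr lecR.
Qed.

Theorem proposition3p4 (R : realType) (F : set (nat -> R[i]))
    (F_neq0 : F !=set0) (F_countable : countable F) (F_pos : F `<=` @c0_pos R) :
  exists2 g : nat -> R[i], c0_pos g &
    forall f, F f -> c0_ideal f `<=` c0_ideal g.
Proof.
(* Repetitions are allowed, so a finite non-empty [F] is enumerated as well. *)
have [e Fe] : exists e : nat -> nat -> R[i], F = range e.
  have [F0|[e]] := pfcard_geP F_countable; last first.
    by exists e; rewrite image_eq.
  by case: F_neq0; rewrite F0.
have e_real k : e k = (fun n => (complex.Re (e k n))%:C).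
  apply/funext => n; rewrite RRe_real // ger0_real //.
  by have [|_ ->] := F_pos (e k); rewrite // Fe; exists k.
have e_pos k : c0_pos (e k) by apply: F_pos; rewrite Fe; exists k.
have [k n|k|g [g_gt0 g_cvg dom]] :=
    countable_null_seq_dominated (fun k n => complex.Re (e k n)).
- by have [_ /(_ n)] := e_pos k; rewrite {1}e_real lecR.
- by apply/c0_real; rewrite -e_real; have [] := e_pos k.
exists (fun n => (g n)%:C).
  by split=> [|n]; [exact/c0_real | rewrite lecR ltW].
move=> f; rewrite Fe => -[k _ <-] h [h_c0 [c c_ge0 h_le]]; split=> //.
have [d d_ge0 e_le] := dom k.
(* Chain [|h| <= c * e k] with [e k <= d * g]. *)
exists (c * d) => [|n]; first exact: mulr_ge0.
apply: le_trans (h_le n) _.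
by rewrite e_real -!rmorphM lecR -mulrA ler_wpM2l.
Qed.
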